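(* Let the standing assumptions (i)–(v) and the solvability assumption of the context hold, let $f$ be convex, and let $\psi=\phi=\|\cdot\|^2/2$, $\Omega=\mathbb R^n$. Run GA-BPGc (described in the context) with $\gamma_+=1$ and $\kappa_0\ge2$, and set $\underline\lambda=\min\{\lambda_0,1/(\gamma_-L)\}$. Then $\lambda_k\ge\underline\lambda$ and $\kappa_k=\kappa_0$ at every completed iteration. For every $N\ge1$ (completed iterations) and $u\in\operatorname{dom}\Phi$, $$\Phi(y_N)-\Phi(u)\le\frac{\kappa_0\|u-z_0\|^2}{\underline\lambda N^2}.$$ The number of BPG solves (computations of a point of some $T_\lambda(x)$, including rejected trials and stopping checks) through $N$ completed iterations is $O(N)$.
   Context: Notation. $\langle\cdot,\cdot\rangle$ and $\|\cdot\|$ are the Euclidean inner product and norm on $\mathbb R^n$. For $h:\mathbb R^n\to(-\infty,+\infty]$, $\operatorname{dom}h=\{h<+\infty\}$ and $h^*$ is the convex conjugate. A proper lower semicontinuous convex function is Legendre if it is essentially smooth and essentially strictly convex; then $\nabla h^*=(\nabla h)^{-1}$ on $\operatorname{int}\operatorname{dom}h^*$. For $v$ where $h$ is differentiable, $D_h(u,v)=h(u)-h(v)-\langle\nabla h(v),u-v\rangle$; the same notation is used for $f$. Standing assumptions. (i) $\psi:\mathbb R^n\to(-\infty,+\infty]$ is Legendre and $\Omega=\operatorname{int}\operatorname{dom}\psi$. (ii) $f:\mathbb R^n\to(-\infty,+\infty]$ is proper, lower semicontinuous, $\operatorname{dom}\psi\subset\operatorname{dom}f$, and $f$ is continuously differentiable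 on $\Omega$. (iii) $\rho:\mathbb R^n\to(-\infty,+\infty]$ is proper, lower semicontinuous, convex, with $\Omega\cap\operatorname{dom}\rho\ne\emptyset$. (iv) There is $L>0$ with $D_f(u,v)\le L D_\psi(u,v)$ for all $u,v\in\Omega$. (v) With $\Phi=f+\rho$, $\Phi^\star=\inf_{x\in\operatorname{cl}\Omega}\Phi(x)>-\infty$. BPG map. For $x\in\Omega$, $\lambda>0$, $$T_\lambda(x)=\operatorname{argmin}_{u\in\operatorname{cl}\Omega}\{\rho(u)+\langle\nabla f(x),u-x\rangle+\lambda^{-1}D_\psi(u,x)\}.$$ Solvability assumption: $T_\lambda(x)\neq\emptyset$ for every $x\in\Omega$, $\lambda>0$ (the minimizer is then unique and lies in $\Omega$). For $\widehat y\in T_\lambda(x)$ put $g_\lambda(x)=(\nabla\psi(x)-\nabla\psi(\widehat y))/\lambda$ and $P_\lambda(x)=\lambda^{-1}[D_\psi(x,\widehat y)+D_\psi(\widehat y,x)]-D_f(\widehat y,x)$. GA-BPGc. Inputs: a Legendre function $\phi:\mathbb R^n\to(-\infty,+\infty]$; $y_0\in\Omega\cap\operatorname{dom}\rho\cap\operatorname{int}\operatorname{dom}\phi$; $\lambda_0,\kappa_0>0$; $\gamma_+\ge1$; $\gamma_-,\gamma_\kappa>1$. Set $z_0=y_0$, $\omega_0=0$. For $k=1,2,\dots$: if $y_{k-1}\in T_{\lambda_{k-1}}(y_{k-1})$, stop and return $y_{k-1}$. Otherwise set $\lambda=\gamma_+\lambda_{k-1}$, $\kappa=\kappa_{k-1}/\gamma_+$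 and repeat trials: (a) $\alpha=(\lambda+\sqrt{\lambda^2+2\kappa\lambda\omega_{k-1}})/\kappa$, $\omega=\omega_{k-1}+\alpha$ (so $\kappa\alpha^2=2\lambda\omega$), $x=(\omega_{k-1}y_{k-1}+\alpha z_{k-1})/\omega$; (b) $\widehat y\in T_\lambda(x)$; if $\widehat y=x$, stop and return $x$; (c) if $D_f(\widehat y,x)>\lambda^{-1}D_\psi(\widehat y,x)$, replace $\lambda$ by $\lambda/\gamma_-$ and go to (a); (d) $p=\nabla\phi(z_{k-1})-\alpha g_\lambda(x)$; if $p\notin\operatorname{int}\operatorname{dom}\phi^*$, replace $\kappa$ by $\gamma_\kappa\kappa$ and go to (a); (e) $\widehat z=\nabla\phi^*(p)$; if $\widehat z\notin\Omega$ or $D_\phi(z_{k-1},\widehat z)>\omega P_\lambda(x)+\omega_{k-1}D_f(y_{k-1},x)$, replace $\kappa$ by $\gamma_\kappa\kappa$ and go to (a); (f) otherwise accept: $(\alpha_k,\omega_k,x_k,y_k,z_k,\lambda_k,\kappa_k)=(\alpha,\omega,x,\widehat y,\widehat z,\lambda,\kappa)$. An iteration is completed when a trial is accepted. *)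

(* Defs.v *)
From HB Require Import structures.
From mathcomp Require Import all_boot all_order all_algebra.
From mathcomp Require Import all_classical all_reals all_analysis.

Set Implicit Arguments.
Unset Strict Implicit.
Unset Printing Implicit Defensive.

Import Order.TTheory GRing.Theory Num.Theory numFieldNormedType.Exports.

Local Open Scope classical_set_scope.
Local Open Scope ring_scope.

(* The norm carried by the normed module 'rV[R]_n is the sup norm. It induces
   the usual topology (interior, closure, limits, differentiability), but all
   metric quantities below use the Euclidean structure [dotp], [enorm]. *)
Section Euclidean.
Context {R : realType} {n : nat}.
Implicit Types u v x : 'rV[R]_n.

Definition dotp u v : R := \sum_(i < n) u 0 i * v 0 i.

Definition enorm u : R := Num.sqrt (dotp u u).

Definition half_sqnorm u : \bar R := (enorm u ^+ 2 / 2)%:E.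

End Euclidean.

(* A function R^n -> (-oo, +oo] is a function h : 'rV[R]_n -> \bar R that never
   takes the value -oo; this is part of [proper_fun]. *)
Section ConvexAnalysis.
Context {R : realType} {n : nat}.
Implicit Types (h : 'rV[R]_n -> \bar R) (x y u v p : 'rV[R]_n).

Definition dom h : set 'rV[R]_n := [set x | (h x < +oo)%E].

Definition proper_fun h := (forall x, h x != -oo%E) /\ dom h !=set0.

Definition econvex h := forall x y (t : R), 0 <= t <= 1 ->
  (h (t *: x + (1 - t) *: y)%R <= t%:E * h x + (1 - t)%:E * h y)%E.

Definition conjugate h p : \bar R :=
  ereal_sup (range (fun x => ((dotp p x)%:E - h x)%E)).

(* [fine \o h] agrees with h wherever h is finite, in particular near every
   point of the interior of [dom h]; [grad] is only used at such points. *)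
Definition grad h x : 'rV[R]_n :=
  \row_(i < n) 'd (fine \o h) x (delta_mx 0 i).

Definition subdiff h x : set 'rV[R]_n :=
  [set p | forall u, (h x + (dotp p (u - x))%:E <= h u)%E].

Definition essentially_smooth h :=
  [/\ (dom h)° !=set0,
      forall x, (dom h)° x -> differentiable (fine \o h) x
    & forall (s : nat -> 'rV[R]_n) x, (forall i, (dom h)° (s i)) ->
        (closure (dom h)° `\` (dom h)°) x -> s i @[i --> \oo] --> x ->
        enorm (grad h (s i)) @[i --> \oo] --> +oo].

Definition strictly_convex_on (C : set 'rV[R]_n) h :=
  forall x y (t : R), C x -> C y -> x != y -> 0 < t < 1 ->
  (h (t *: x + (1 - t) *: y)%R < t%:E * h x + (1 - t)%:E * h y)%E.

Definition essentially_strictly_convex h :=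
  forall C : set 'rV[R]_n, @convex_set R 'rV[R]_n C ->
    C `<=` [set x | subdiff h x !=set0] -> strictly_convex_on C h.

Record legendre h : Prop := Legendre {
  legendre_proper : proper_fun h;
  legendre_lsc : lower_semicontinuous h;
  legendre_convex : econvex h;
  legendre_smooth : essentially_smooth h;
  legendre_strict : essentially_strictly_convex h }.

(* D_h(u, v), meaningful when h is differentiable at v (so h v is finite); its
   value is +oo when h u = +oo. *)
Definition bregman h u v : \bar R :=
  (h u - h v - (dotp (grad h v) (u - v))%:E)%E.

End ConvexAnalysis.

Section BPG.
Context {R : realType} {n : nat}.
Variables (psi f rho : 'rV[R]_n -> \bar R).

Definition Omega : set 'rV[R]_n := (dom psi)°.

Definition Phi (x : 'rV[R]_n) : \bar R := (f x + rho x)%E.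

Record standing_assumptions (L : R) : Prop := StandingAssumptions {
  sa_psi_legendre : legendre psi;
  sa_f_proper : proper_fun f;
  sa_f_lsc : lower_semicontinuous f;
  sa_dom : dom psi `<=` dom f;
  sa_f_diff : forall x, Omega x -> differentiable (fine \o f) x;
  sa_f_C1 : forall x, Omega x -> {for x, continuous (grad f)};
  sa_rho_proper : proper_fun rho;
  sa_rho_lsc : lower_semicontinuous rho;
  sa_rho_convex : econvex rho;
  sa_rho_dom : Omega `&` dom rho !=set0;
  sa_L_gt0 : 0 < L;
  sa_smooth : forall u v, Omega u -> Omega v ->
    (bregman f u v <= L%:E * bregman psi u v)%E;
  sa_bounded : (-oo < ereal_inf (Phi @` closure Omega))%E }.

Definition bpg_objective (lambda : R) (x u : 'rV[R]_n) : \bar R :=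
  (rho u + (dotp (grad f x) (u - x))%:E + (lambda^-1)%:E * bregman psi u x)%E.

(* T_lambda(x), as the set of all minimizers. *)
Definition bpg (lambda : R) (x : 'rV[R]_n) : set 'rV[R]_n :=
  [set u | closure Omega u /\ forall v, closure Omega v ->
    (bpg_objective lambda x u <= bpg_objective lambda x v)%E].

Definition solvable :=
  forall (x : 'rV[R]_n) (lambda : R), Omega x -> 0 < lambda ->
    bpg lambda x !=set0.

(* g_lambda(x) and P_lambda(x), for a given yhat in T_lambda(x). *)
Definition bpg_g (lambda : R) (x yhat : 'rV[R]_n) : 'rV[R]_n :=
  lambda^-1 *: (grad psi x - grad psi yhat).

Definition bpg_P (lambda : R) (x yhat : 'rV[R]_n) : \bar R :=
  ((lambda^-1)%:E * (bregman psi x yhat + bregman psi yhat x)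
   - bregman f yhat x)%E.

End BPG.

Section GABPGc.
Context {R : realType} {n : nat}.

Record ga_inputs (psi rho phi : 'rV[R]_n -> \bar R) (y0 : 'rV[R]_n)
    (lambda0 kappa0 gammap gammam gammak : R) : Prop := GaInputs {
  gi_phi : legendre phi;
  gi_y0_Omega : Omega psi y0;
  gi_y0_rho : dom rho y0;
  gi_y0_phi : (dom phi)° y0;
  gi_lambda0 : 0 < lambda0;
  gi_kappa0 : 0 < kappa0;
  gi_gammap : 1 <= gammap;
  gi_gammam : 1 < gammam;
  gi_gammak : 1 < gammak }.

(* What one iteration passes on to the next. *)
Record ga_state := GaState {
  st_y : 'rV[R]_n;
  st_z : 'rV[R]_n;
  st_omega : R;
  st_lambda : R;
  st_kappa : R }.

Definition ga_init (y0 : 'rV[R]_n) (lambda0 kappa0 : R) : ga_state :=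
  GaState y0 y0 0 lambda0 kappa0.

Definition ga_alpha (s : ga_state) (lambda kappa : R) : R :=
  (lambda + Num.sqrt (lambda ^+ 2 + 2 * kappa * lambda * st_omega s)) / kappa.

Definition ga_omega (s : ga_state) (lambda kappa : R) : R :=
  st_omega s + ga_alpha s lambda kappa.

Definition ga_x (s : ga_state) (lambda kappa : R) : 'rV[R]_n :=
  (ga_omega s lambda kappa)^-1 *:
    (st_omega s *: st_y s + ga_alpha s lambda kappa *: st_z s).

(* In each constructor, k is the number of iterations completed so far.
   [Outer k s]: iteration k+1 is about to start from the state s (so, for
   k >= 1, s holds y_k, z_k, omega_k, lambda_k, kappa_k).
   [Inner k s lambda kappa]: iteration k+1 is about to run a trial with the
   parameters lambda, kappa.
   [Stopped k x]: the algorithm has returned x. *)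
Inductive ga_config :=
| Outer of nat & ga_state
| Inner of nat & ga_state & R & R
| Stopped of nat & 'rV[R]_n.

Variables (psi f rho phi : 'rV[R]_n -> \bar R).
Variables (y0 : 'rV[R]_n) (lambda0 kappa0 gammap gammam gammak : R).

Definition ga_p (s : ga_state) (lambda kappa : R) (yhat : 'rV[R]_n) : 'rV[R]_n :=
  grad phi (st_z s) -
  ga_alpha s lambda kappa *: bpg_g psi lambda (ga_x s lambda kappa) yhat.

Definition ga_zhat (s : ga_state) (lambda kappa : R) (yhat : 'rV[R]_n) :
    'rV[R]_n :=
  grad (conjugate phi) (ga_p s lambda kappa yhat).

(* The rejection tests of steps (c), (d) and (e) of a trial. *)
Definition ga_reject_c (s : ga_state) (lambda kappa : R) (yhat : 'rV[R]_n) :=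
  let x := ga_x s lambda kappa in
  (bregman f yhat x > (lambda^-1)%:E * bregman psi yhat x)%E.

Definition ga_reject_d (s : ga_state) (lambda kappa : R) (yhat : 'rV[R]_n) :=
  ~ (dom (conjugate phi))° (ga_p s lambda kappa yhat).

Definition ga_reject_e (s : ga_state) (lambda kappa : R) (yhat : 'rV[R]_n) :=
  let x := ga_x s lambda kappa in
  let zhat := ga_zhat s lambda kappa yhat in
  ~ Omega psi zhat \/
  (bregman phi (st_z s) zhat >
     (ga_omega s lambda kappa)%:E * bpg_P psi f lambda x yhat
     + (st_omega s)%:E * bregman f (st_y s) x)%E.

(* [ga_step c c'] performs either the stopping check that opens an iteration or
   one trial; each of these computes exactly one BPG solve. *)
Inductive ga_step : ga_config -> ga_config -> Prop :=
| step_check_stop k s :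
    bpg psi f rho (st_lambda s) (st_y s) (st_y s) ->
    ga_step (Outer k s) (Stopped k (st_y s))
| step_check_continue k s :
    ~ bpg psi f rho (st_lambda s) (st_y s) (st_y s) ->
    ga_step (Outer k s)
            (Inner k s (gammap * st_lambda s) (st_kappa s / gammap))
| step_trial_stop k s lambda kappa yhat :
    bpg psi f rho lambda (ga_x s lambda kappa) yhat ->
    yhat = ga_x s lambda kappa ->
    ga_step (Inner k s lambda kappa) (Stopped k (ga_x s lambda kappa))
| step_reject_lambda k s lambda kappa yhat :
    bpg psi f rho lambda (ga_x s lambda kappa) yhat ->
    yhat <> ga_x s lambda kappa ->
    ga_reject_c s lambda kappa yhat ->
    ga_step (Inner k s lambda kappa) (Inner k s (lambda / gammam) kappa)
| step_reject_kappa k s lambda kappa yhat :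
    bpg psi f rho lambda (ga_x s lambda kappa) yhat ->
    yhat <> ga_x s lambda kappa ->
    ~ ga_reject_c s lambda kappa yhat ->
    ga_reject_d s lambda kappa yhat \/ ga_reject_e s lambda kappa yhat ->
    ga_step (Inner k s lambda kappa) (Inner k s lambda (gammak * kappa))
| step_accept k s lambda kappa yhat :
    bpg psi f rho lambda (ga_x s lambda kappa) yhat ->
    yhat <> ga_x s lambda kappa ->
    ~ ga_reject_c s lambda kappa yhat ->
    ~ ga_reject_d s lambda kappa yhat ->
    ~ ga_reject_e s lambda kappa yhat ->
    ga_step (Inner k s lambda kappa)
            (Outer k.+1 (GaState yhat (ga_zhat s lambda kappa yhat)
                                 (ga_omega s lambda kappa) lambda kappa)).

(* [ga_reach c m]: the algorithm can be in configuration c after exactly m BPG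
   solves. *)
Inductive ga_reach : ga_config -> nat -> Prop :=
| reach_init : ga_reach (Outer 0 (ga_init y0 lambda0 kappa0)) 0
| reach_step c c' m : ga_reach c m -> ga_step c c' -> ga_reach c' m.+1.

(* c occurs no later than the completion of the N-th iteration. *)
Definition ga_through (N : nat) (c : ga_config) : bool :=
  match c with
  | Outer k _ => (k <= N)%N
  | Inner k _ _ _ => (k < N)%N
  | Stopped k _ => (k < N)%N
  end.

End GABPGc.

(* Main.v *)
Require Import Defs.
From HB Require Import structures.
From mathcomp Require Import all_boot all_order all_algebra.
From mathcomp Require Import all_classical all_reals all_analysis.
From mathcomp Require Import ring lra.

Set Implicit Arguments.
Unset Strict Implicit.
Unset Printing Implicit Defensive.

Import Order.TTheory GRing.Theory Num.Theory numFieldNormedType.Exports.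

Local Open Scope classical_set_scope.
Local Open Scope ring_scope.

(** In the Euclidean case the mirror maps are the identity, so a trial reads
    y = prox(x), zhat = z - alpha g with g = (x - y) / lambda.

    _No trial is rejected for kappa._  The equation kappa alpha^2 = 2 lambda
    omega defining alpha gives D_phi(z, zhat) = alpha^2 |g|^2 / 2
    = omega |x - y|^2 / (kappa lambda), while a trial that passed test (c) has
    P_lambda(x) >= |x - y|^2 / (2 lambda).  As kappa >= 2 and D_f >= 0 by
    convexity, test (e) holds (lemma [trial_no_reject_kappa]); test (d) is void
    because the conjugate of phi is finite everywhere.  Hence kappa stays equal
    to kappa0.

    _lambda is bounded below._  Test (c) fails only if 1 / lambda < L, so a
    reduced lambda stays above 1 / (gammam L) (lemma [reject_lambda_low]).
    Since gammap = 1, lambda never increases, so the whole run contains a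
    bounded number of reductions; apart from these, an iteration costs one
    stopping check and one accepted trial.  This gives the O(N) count
    (lemma [reach_solves]).

    _Rate._  Add the optimality inequality of the proximal step at u, with
    weight alpha, to the one at the previous y, with weight omega_-, where
    omega_- denotes the previous omega.  Since
    omega x = omega_- y_- + alpha z, the linear terms combine into
    alpha <g, u - z>, which is the cross term of |u - zhat|^2, and test (e) pays
    for what remains.  So omega (Phi(y) - Phi(u)) + |u - z|^2 / 2 does not
    increase (lemma [trial_lyapunov]).  It starts at |u - z0|^2 / 2 because
    omega_0 = 0, and the recursion for omega forces
    omega_N >= lambda_low N^2 / (2 kappa0) (lemma [ga_omega_growth]). *)

(** * Euclidean inner product *)

Section Euclidean.
Context {R : realType} {n : nat}.
Implicit Types (u v w x : 'rV[R]_n) (a t : R).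

Lemma dotpC u v : dotp u v = dotp v u.
Proof. by apply: eq_bigr => i _; rewrite mulrC. Qed.

Lemma dotpDl u v w : dotp (u + v) w = dotp u w + dotp v w.
Proof. by rewrite -big_split; apply: eq_bigr => i _; rewrite mxE mulrDl. Qed.

Lemma dotpZl a u v : dotp (a *: u) v = a * dotp u v.
Proof.
by rewrite /dotp mulr_sumr; apply: eq_bigr => i _; rewrite mxE mulrA.
Qed.

Lemma dotpDr u v w : dotp u (v + w) = dotp u v + dotp u w.
Proof. by rewrite !(dotpC u) dotpDl. Qed.

Lemma dotpZr a u v : dotp u (a *: v) = a * dotp u v.
Proof. by rewrite !(dotpC u) dotpZl. Qed.

Lemma dotpNl u v : dotp (- u) v = - dotp u v.
Proof. by rewrite -scaleN1r dotpZl mulN1r. Qed.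

Lemma dotpNr u v : dotp u (- v) = - dotp u v.
Proof. by rewrite !(dotpC u) dotpNl. Qed.

Definition dotpE := (dotpDl, dotpDr, dotpNl, dotpNr, dotpZl, dotpZr).

Lemma dotp_subC u v : dotp (u - v) (u - v) = dotp (v - u) (v - u).
Proof. by rewrite -(opprB v u) dotpNl dotpNr opprK. Qed.

Lemma dotp_ge0 u : 0 <= dotp u u.
Proof. by apply: sumr_ge0 => i _; rewrite -expr2 sqr_ge0. Qed.

Lemma enorm_sq u : enorm u ^+ 2 = dotp u u.
Proof. by rewrite sqr_sqrtr ?dotp_ge0. Qed.

Lemma half_sqnormE u : half_sqnorm u = (dotp u u / 2)%:E.
Proof. by rewrite /half_sqnorm enorm_sq. Qed.

Lemma dom_half_sqnorm : dom (@half_sqnorm R n) = setT.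
Proof. by apply/seteqP; split => // u _; rewrite /dom /= half_sqnormE ltry. Qed.

Lemma dotp_delta u i : dotp u (delta_mx 0 i) = u 0 i.
Proof.
rewrite /dotp (bigD1 i)//= mxE !eqxx mulr1 big1 ?addr0// => j ji.
by rewrite mxE (negbTE ji) andbF mulr0.
Qed.

End Euclidean.


(** * Gradients, Bregman distances and the half squared norm *)

Section Gradient.
Context {R : realType} {n : nat}.
Implicit Types (h : 'rV[R]_n -> \bar R) (u v w x : 'rV[R]_n).

(** The differential is linear, so its values on the basis vectors collected in
    [grad] determine every directional derivative. *)
Lemma dotp_grad h x v : differentiable (fine \o h) x ->
  dotp (grad h x) v = 'D_v (fine \o h) x.
Proof.
move=> dh; rewrite deriveE// [in RHS](row_sum_delta v) linear_sum.
by apply: eq_bigr => i _; rewrite linearZ mxE mulrC.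
Qed.

Lemma bregmanE h u v : h u \is a fin_num -> h v \is a fin_num ->
  bregman h u v =
  (fine (h u) - fine (h v) - dotp (grad h v) (u - v))%:E.
Proof. by rewrite /bregman; case: (h u) (h v) => [a| |] [b| |]. Qed.

Lemma differentiable_half_sqnorm x : differentiable (fine \o half_sqnorm) x.
Proof.
have -> : fine \o @half_sqnorm R n =
    (2^-1 \*: (\sum_(i < n) (fun u => u 0 i * u 0 i))).
  apply/funext => u; rewrite [LHS]/comp half_sqnormE /= mulrC; congr (_ * _).
  by rewrite fct_sumE.
apply: differentiableZ; apply: differentiable_sum => i.
by apply: differentiableM; exact: differentiable_coord.
Qed.

Lemma grad_half_sqnorm x : grad half_sqnorm x = x.
Proof.
apply/rowP => i; rewrite -(dotp_delta (grad _ _)) -[RHS]dotp_delta.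
set v := delta_mx 0 i.
rewrite dotp_grad; last exact: differentiable_half_sqnorm.
apply: cvg_lim => //.
have cv : dotp x v + h * (dotp v v / 2) @[h --> (0:R)^'] --> dotp x v.
  rewrite -[X in _ --> X]addr0 -[X in _ --> _ + X](mul0r (dotp v v / 2)).
  apply: cvgD; first exact: cvg_cst.
  by apply: cvgMr_tmp; apply: cvg_within.
apply: cvg_trans cv; apply: near_eq_cvg.
near=> h; have h0 : h != 0 by near: h; exact: nbhs_dnbhs_neq.
rewrite /= !enorm_sq !dotpE (dotpC v x) /GRing.scale /=.
by field.
Unshelve. all: by end_near. Qed.

Lemma bregman_half_sqnorm u v :
  bregman half_sqnorm u v = (dotp (u - v) (u - v) / 2)%:E.
Proof.
rewrite bregmanE ?half_sqnormE// grad_half_sqnorm /=; congr _%:E.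
by rewrite !dotpE (dotpC v u); field.
Qed.

(** Expanding |p - x|^2 >= 0 bounds the supremum, and x = p attains it. *)
Lemma conjugate_half_sqnorm : conjugate (@half_sqnorm R n) = half_sqnorm.
Proof.
apply/funext => p; apply/eqP; rewrite eq_le; apply/andP; split.
  apply: ge_ereal_sup => _ [x _ <-]; rewrite !half_sqnormE lee_fin.
  by have := dotp_ge0 (p - x); rewrite !dotpE (dotpC x p); lra.
apply: ereal_sup_ubound; exists p => //; rewrite half_sqnormE -EFinB.
by congr _%:E; field.
Qed.

Lemma dom_fin_num h u : proper_fun h -> dom h u -> h u \is a fin_num.
Proof. by move=> [hNy _] hu; rewrite fin_numE hNy lt_eqF. Qed.

(** Convexity as an inequality between real numbers; finiteness at the
    intermediate point comes with it. *)
Lemma econvex_fine h u v t : proper_fun h -> econvex h -> dom h u -> dom h v ->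
  0 <= t <= 1 ->
  dom h (t *: u + (1 - t) *: v) /\
  fine (h (t *: u + (1 - t) *: v)) <= t * fine (h u) + (1 - t) * fine (h v).
Proof.
move=> hproper hcvx hu hv t01; have := hcvx u v t t01.
rewrite -(fineK (dom_fin_num hproper hu)) -(fineK (dom_fin_num hproper hv)).
rewrite -!EFinM -EFinD => hle.
have hw : dom h (t *: u + (1 - t) *: v) := le_lt_trans hle (ltry _).
split=> //; move: hle.
by rewrite -[X in (X <= _)%E](fineK (dom_fin_num hproper hw)).
Qed.

(** Convexity bounds the difference quotients in the direction u - v by
    h(u) - h(v) for steps in (0, 1]; let the step tend to 0 from the right. *)
Lemma convex_bregman_ge0 h u v : proper_fun h -> econvex h ->
  dom h u -> dom h v -> differentiable (fine \o h) v -> (0 <= bregman h u v)%E.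
Proof.
move=> hproper hcvx hu hv dh.
rewrite bregmanE ?dom_fin_num// lee_fin subr_ge0 dotp_grad//.
have dv : derivable (fine \o h) v (u - v) by exact: diff_derivable.
apply: (@cvgr_to_le _ (0 : R)^'+ _ _
  (fun t : R => t^-1 *: ((fine \o h) (t *: (u - v) + v) - (fine \o h) v))).
  exact: cvg_dnbhs_at_right dv.
near=> t; have t0 : 0 < t by near: t; exact: nbhs_right_gt.
have t1 : t <= 1 by near: t; exact: nbhs_right_le.
rewrite /GRing.scale /= ler_pdivrMl//.
have -> : t *: (u - v) + v = t *: u + (1 - t) *: v.
  by apply/rowP => i; rewrite !mxE; ring.
have t01 : 0 <= t <= 1 by rewrite t1 ltW.
by have [_] := econvex_fine hproper hcvx hu hv t01; lra.
Unshelve. all: by end_near. Qed.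

End Gradient.

(** * The proximal step *)

Section EuclideanProximalStep.
Context {R : realType} {n : nat}.
Variables (f rho : 'rV[R]_n -> \bar R).
Hypotheses (rho_proper : proper_fun rho) (rho_convex : econvex rho).
Implicit Types (u v x y : 'rV[R]_n) (lambda : R).

Lemma Omega_half_sqnorm : Omega (@half_sqnorm R n) = setT.
Proof. by rewrite /Omega dom_half_sqnorm interiorT. Qed.

Lemma bpg_g_half_sqnorm lambda x y :
  bpg_g half_sqnorm lambda x y = lambda^-1 *: (x - y).
Proof. by rewrite /bpg_g !grad_half_sqnorm. Qed.

Lemma bpg_objective_half_sqnorm lambda x u : dom rho u ->
  bpg_objective half_sqnorm f rho lambda x u =
  (fine (rho u) + dotp (grad f x) (u - x)
   + lambda^-1 * (dotp (u - x) (u - x) / 2))%:E.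
Proof.
move=> hu; rewrite /bpg_objective bregman_half_sqnorm.
by rewrite -[X in (X + _ + _)%E](fineK (dom_fin_num rho_proper hu)).
Qed.

(** The objective differs from rho by finite terms and is finite at some point,
    so rho is finite at a minimizer. *)
Lemma bpg_dom lambda x y : bpg half_sqnorm f rho lambda x y -> dom rho y.
Proof.
move=> [_ hmin]; have [v hv] := rho_proper.2.
have := hmin v; rewrite Omega_half_sqnorm closureT => /(_ I).
rewrite (bpg_objective_half_sqnorm _ _ hv) /bpg_objective bregman_half_sqnorm.
rewrite /dom /= => hle; have := le_lt_trans hle (ltry _).
by case: (rho y) => [r _| |//]; [exact: ltry|].
Qed.

Lemma linear_part_ge0 (A B : R) : 0 <= B ->
  (forall t, 0 < t -> t <= 1 -> 0 <= t * A + t ^+ 2 * B) -> 0 <= A.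
Proof.
move=> B0 hAB; rewrite leNgt; apply/negP => A0.
have BA : 0 < B - A by lra.
(* At t = - A / (B - A) the bound t A + t^2 B equals A^3 / (B - A)^2 < 0. *)
have t0 : 0 < - A / (B - A) by rewrite divr_gt0// oppr_gt0.
have t1 : - A / (B - A) <= 1 by rewrite ler_pdivrMr// mul1r; lra.
have := hAB _ t0 t1.
have -> : - A / (B - A) * A + (- A / (B - A)) ^+ 2 * B = A ^+ 3 / (B - A) ^+ 2.
  by field; rewrite gt_eqF.
have neg : A ^+ 3 / (B - A) ^+ 2 < 0.
  by rewrite pmulr_llt0 ?invr_gt0 ?exprn_gt0// exprn_odd_lt0.
lra.
Qed.

(** First-order optimality: g - grad f(x) is a subgradient of rho at y.  The
    minimizer is compared with the points t u + (1 - t) y; by convexity of rho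
    the objective changes there by at most t A + t^2 B, where A is the
    difference of the two sides, and letting t tend to 0 gives A >= 0. *)
Lemma bpg_optimality lambda x y u : 0 < lambda ->
  bpg half_sqnorm f rho lambda x y -> dom rho u ->
  fine (rho y) + dotp (bpg_g half_sqnorm lambda x y - grad f x) (u - y)
  <= fine (rho u).
Proof.
move=> l0 hbpg hu; have hy := bpg_dom hbpg; case: hbpg => _ hmin.
rewrite bpg_g_half_sqnorm -subr_ge0.
pose B := lambda^-1 * (dotp (u - y) (u - y) / 2).
apply: (@linear_part_ge0 _ B).
  by rewrite mulr_ge0 ?invr_ge0 ?divr_ge0 ?dotp_ge0// ltW.
move=> t t0 t1.
have t01 : 0 <= t <= 1 by rewrite ltW.
have [hw rw] := econvex_fine rho_proper rho_convex hu hy t01.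
have := hmin (t *: u + (1 - t) *: y).
rewrite Omega_half_sqnorm closureT => /(_ I).
rewrite !bpg_objective_half_sqnorm// lee_fin.
have -> : t *: u + (1 - t) *: y - x = (y - x) + t *: (u - y).
  by apply/rowP => i; rewrite !mxE; ring.
have -> : x - y = - (y - x) by rewrite opprB.
rewrite /B; move: (y - x) (u - y) => a b.
rewrite !dotpE (dotpC b a); lra.
Qed.

End EuclideanProximalStep.

(** * One trial *)

Section Trial.
Context {R : realType} {n : nat}.
Variables (f rho : 'rV[R]_n -> \bar R).
Hypotheses (rho_proper : proper_fun rho) (rho_convex : econvex rho).
Hypotheses (f_proper : proper_fun f) (f_convex : econvex f).
Hypotheses (f_dom : forall x, dom f x).
Hypothesis (f_diff : forall x, differentiable (fine \o f) x).
Variables (s : @ga_state R n) (lambda kappa : R).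
Hypotheses (lambda0 : 0 < lambda) (kappa0 : 0 < kappa).
Hypothesis (omega0 : 0 <= st_omega s).

Let alpha := ga_alpha s lambda kappa.
Let omega := ga_omega s lambda kappa.
Let x := ga_x s lambda kappa.
Let disc := lambda ^+ 2 + 2 * kappa * lambda * st_omega s.

Let disc_ge0 : 0 <= disc.
Proof. by rewrite addr_ge0 ?sqr_ge0// !mulr_ge0// ltW. Qed.

Lemma ga_alpha_gt0 : 0 < alpha.
Proof. by rewrite divr_gt0// ltr_wpDr ?sqrtr_ge0. Qed.

Lemma ga_omega_gt0 : 0 < omega.
Proof. by rewrite ltr_wpDl// ga_alpha_gt0. Qed.

(** alpha is the positive root of kappa a^2 - 2 lambda a - 2 lambda omega_-. *)
Lemma ga_alpha_sq : kappa * alpha ^+ 2 = 2 * lambda * omega.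
Proof.
rewrite /omega /ga_omega -/alpha.
have : Num.sqrt disc ^+ 2 = disc by rewrite sqr_sqrtr.
have -> : Num.sqrt disc = kappa * alpha - lambda.
  by rewrite /alpha /ga_alpha mulrC divfK ?gt_eqF// addrC addKr.
have kn : kappa != 0 by rewrite gt_eqF.
rewrite /disc => h; apply: (mulfI kn); lra.
Qed.

(** By the inductive bound the square root in alpha is at least low k, so
    2 kappa alpha >= 2 low (k + 1), which is at least low ((k + 1)^2 - k^2). *)
Lemma ga_omega_growth (low : R) (k : nat) : 0 <= low -> low <= lambda ->
  low * k%:R ^+ 2 <= 2 * kappa * st_omega s ->
  low * k.+1%:R ^+ 2 <= 2 * kappa * omega.
Proof.
move=> low0 lowl hk; rewrite /omega /ga_omega -/alpha.
have hsq : low * k%:R <= Num.sqrt disc.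
  rewrite -[X in X <= _]ger0_norm ?mulr_ge0 ?ler0n// -sqrtr_sqr ler_wsqrtr//.
  have := ler_pM low0 _ lowl hk; rewrite mulr_ge0 ?sqr_ge0// => /(_ isT).
  by have := sqr_ge0 lambda; rewrite /disc; lra.
have : kappa * alpha = lambda + Num.sqrt disc.
  by rewrite /alpha /ga_alpha mulrC divfK ?gt_eqF.
rewrite -natr1; lra.
Qed.

Variable yhat : 'rV[R]_n.
Hypothesis (yhat_bpg : bpg half_sqnorm f rho lambda x yhat).

Let fin_f u : f u \is a fin_num := dom_fin_num f_proper (f_dom u).

Let g := lambda^-1 *: (x - yhat).
Let Df u := fine (f u) - fine (f x) - dotp (grad f x) (u - x).

Let bregman_f u : bregman f u x = (Df u)%:E.
Proof. by rewrite bregmanE. Qed.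

Let Df_ge0 u : 0 <= Df u.
Proof.
by rewrite -lee_fin -bregman_f convex_bregman_ge0.
Qed.

Lemma ga_zhat_half_sqnorm :
  ga_zhat half_sqnorm half_sqnorm s lambda kappa yhat = st_z s - alpha *: g.
Proof.
by rewrite /ga_zhat /ga_p conjugate_half_sqnorm !grad_half_sqnorm
  bpg_g_half_sqnorm.
Qed.

Lemma bpg_P_half_sqnorm :
  bpg_P half_sqnorm f lambda x yhat =
  (lambda^-1 * dotp (x - yhat) (x - yhat) - Df yhat)%:E.
Proof.
rewrite /bpg_P !bregman_half_sqnorm bregman_f -EFinD.
by congr (_ - _)%:E; rewrite (dotp_subC yhat) -splitr.
Qed.

(** Both sides of test (e) are multiples of q = |x - yhat|^2: the left one is
    omega q / (kappa lambda), and test (c) makes the right one at least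
    omega q / (2 lambda). *)
Lemma trial_no_reject_kappa : 2 <= kappa ->
  ~ ga_reject_c half_sqnorm f s lambda kappa yhat ->
  ~ (ga_reject_d half_sqnorm half_sqnorm s lambda kappa yhat \/
     ga_reject_e half_sqnorm f half_sqnorm s lambda kappa yhat).
Proof.
move=> kappa2; rewrite /ga_reject_c -/x bregman_f bregman_half_sqnorm lte_fin.
move=> /negP; rewrite -leNgt => hc [|[|]].
- rewrite /ga_reject_d conjugate_half_sqnorm dom_half_sqnorm interiorT.
  by move=> /(_ I).
- by rewrite Omega_half_sqnorm => /(_ I).
rewrite -/x -/omega bregman_f bpg_P_half_sqnorm bregman_half_sqnorm.
rewrite ga_zhat_half_sqnorm lte_fin; apply/negP; rewrite -leNgt.
rewrite dotp_subC in hc.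
rewrite subKr !dotpZl !dotpZr.
have := dotp_ge0 (x - yhat); move: hc; set q := dotp _ _ => hc q0.
have om0 := ga_omega_gt0.
have -> : alpha * (lambda^-1 * (alpha * (lambda^-1 * q))) / 2 =
    omega * (lambda^-1 * (q / kappa)).
  have -> : omega = kappa * alpha ^+ 2 / (2 * lambda).
    by rewrite ga_alpha_sq; field; rewrite gt_eqF.
  by field; rewrite !gt_eqF.
have l1 : omega * (lambda^-1 * (q / kappa)) <= omega * (lambda^-1 * (q / 2)).
  rewrite ler_pM2l// ler_pM2l ?invr_gt0// ler_wpM2l// lef_pV2 ?posrE//.
have l2 : omega * Df yhat <= omega * (lambda^-1 * (q / 2)) by rewrite ler_pM2l.
have l3 : 0 <= st_omega s * Df (st_y s) by rewrite mulr_ge0.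
lra.
Qed.

Let Phi u := fine (f u) + fine (rho u).

(** Sum of the optimality inequality at u (weight alpha) and at the previous y
    (weight omega_-), convexity of f at u (weight alpha), and test (e). *)
Lemma trial_lyapunov u : dom rho (st_y s) -> dom rho u ->
  ~ ga_reject_e half_sqnorm f half_sqnorm s lambda kappa yhat ->
  let zhat := ga_zhat half_sqnorm half_sqnorm s lambda kappa yhat in
  omega * (Phi yhat - Phi u) + dotp (u - zhat) (u - zhat) / 2 <=
  st_omega s * (Phi (st_y s) - Phi u) + dotp (u - st_z s) (u - st_z s) / 2.
Proof.
move=> hy hu /= /not_orP[_]; rewrite -/x -/omega bregman_f bpg_P_half_sqnorm.
rewrite bregman_half_sqnorm ga_zhat_half_sqnorm lte_fin => /negP.
rewrite -leNgt subKr => he.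
have h1 := bpg_optimality rho_proper rho_convex lambda0 yhat_bpg hu.
have h2 := bpg_optimality rho_proper rho_convex lambda0 yhat_bpg hy.
have h3 := Df_ge0 u.
rewrite -[lambda^-1 * _]dotpZl -/g in he.
rewrite bpg_g_half_sqnorm -/g in h1 h2.
have hx : omega *: x = st_omega s *: st_y s + alpha *: st_z s.
  by rewrite /x /ga_x scalerA mulfV ?gt_eqF ?ga_omega_gt0// scale1r.
have hgx : omega * dotp g x =
    st_omega s * dotp g (st_y s) + alpha * dotp g (st_z s).
  by rewrite -!dotpZr hx dotpDr.
have -> : u - (st_z s - alpha *: g) = (u - st_z s) + alpha *: g.
  by rewrite opprB addrCA addrC.
have a0 := ga_alpha_gt0.
have {}h1 := ler_wpM2l (ltW a0) h1.
have {}h2 := ler_wpM2l omega0 h2.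
have {}h3 := mulr_ge0 (ltW a0) h3.
move: he h1 h2 h3 hgx; rewrite /Df /omega /ga_omega -/alpha /Phi.
(* [x] and [g] become opaque so that the expansion stops at them; only the
   relation [hgx] is used. *)
clearbody x g; rewrite !dotpE (dotpC u g) (dotpC (st_z s) g).
lra.
Qed.

End Trial.

(** * Runs of the algorithm *)

Lemma geometric_exponent_bounded (R : realType) (gamma a : R) : 1 < gamma ->
  exists J : nat, forall r : nat, gamma ^+ r <= a -> (r <= J)%N.
Proof.
move=> g1; exists (Num.bound `|a / (gamma - 1)|) => r hr.
(* Bernoulli's inequality turns the bound on the power into one on r. *)
have bernoulli : 1 + r%:R * (gamma - 1) <= gamma ^+ r.
  elim: r {hr} => [|r IH]; first by rewrite mul0r addr0 expr0.
  rewrite exprS -natr1.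
  have := ler_wpM2l (ltW (lt_trans ltr01 g1)) IH.
  have := mulr_ge0 (ler0n R r) (sqr_ge0 (gamma - 1)); lra.
have g0 : 0 < gamma - 1 by rewrite subr_gt0.
rewrite -(ler_nat R) ltW//; apply: le_lt_trans (archi_boundP (normr_ge0 _)).
by apply: le_trans (ler_norm _); rewrite ler_pdivlMr//; lra.
Qed.

Section Run.
Context {R : realType} {n : nat}.
Variables (f rho : 'rV[R]_n -> \bar R) (L : R) (y0 : 'rV[R]_n).
Variables (lambda0 kappa0 gammam gammak : R).
Hypotheses (rho_proper : proper_fun rho) (rho_convex : econvex rho).
Hypotheses (f_proper : proper_fun f) (f_convex : econvex f).
Hypotheses (f_dom : forall x, dom f x).
Hypothesis (f_diff : forall x, differentiable (fine \o f) x).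
Hypothesis (L_gt0 : 0 < L).
Hypothesis (f_smooth : forall u v,
  (bregman f u v <= L%:E * bregman half_sqnorm u v)%E).
Hypotheses (lambda0_gt0 : 0 < lambda0) (kappa0_ge2 : 2 <= kappa0).
Hypotheses (gammam_gt1 : 1 < gammam) (y0_rho : dom rho y0).

Let lambda_low := Num.min lambda0 (1 / (gammam * L)).
Let step := ga_step half_sqnorm f rho half_sqnorm 1 gammam gammak.
Let reach :=
  ga_reach half_sqnorm f rho half_sqnorm y0 lambda0 kappa0 1 gammam gammak.
Let Psi u := fine (f u) + fine (rho u).

Let kappa0_gt0 : 0 < kappa0.
Proof. by apply: lt_le_trans kappa0_ge2. Qed.

Let gammam_gt0 : 0 < gammam.
Proof. exact: lt_trans gammam_gt1. Qed.

Lemma lambda_low_gt0 : 0 < lambda_low.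
Proof. by rewrite lt_min lambda0_gt0 divr_gt0// mulr_gt0. Qed.

(** The quadratic lower bound on omega and the bound on the Lyapunov function
    that hold after k completed iterations. *)
Definition good_state (k : nat) (s : @ga_state R n) : Prop :=
  [/\ dom rho (st_y s), 0 <= st_omega s,
      lambda_low * k%:R ^+ 2 <= 2 * kappa0 * st_omega s
    & forall u, dom rho u ->
        st_omega s * (Psi (st_y s) - Psi u)
        + dotp (u - st_z s) (u - st_z s) / 2 <= dotp (u - y0) (u - y0) / 2].

(** r is the number of reductions of lambda so far; since lambda stays above
    [lambda_low], r is bounded over the whole run.  The remaining solves are
    counted by [base]: two for each completed iteration, plus those of the
    current one. *)
Definition solve_count (lambda : R) (base m : nat) : Prop :=
  lambda_low <= lambda /\
  exists r : nat, lambda = lambda0 / gammam ^+ r /\ (m <= base + r)%N.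

Definition run_invariant (c : @ga_config R n) (m : nat) : Prop :=
  match c with
  | Outer k s => [/\ good_state k s, st_kappa s = kappa0
                   & solve_count (st_lambda s) k.*2 m]
  | Inner k s lambda kappa => [/\ good_state k s, kappa = kappa0
                                & solve_count lambda k.*2.+1 m]
  | Stopped k _ => exists lambda, solve_count lambda k.*2.+2 m
  end.

Lemma solve_countS lambda b m :
  solve_count lambda b m -> solve_count lambda b.+1 m.+1.
Proof. by move=> [? [r [? ?]]]; split=> //; exists r. Qed.

Lemma solve_count_weaken lambda b m :
  solve_count lambda b m -> solve_count lambda b.+1 m.
Proof. by move=> [? [r [? h]]]; split=> //; exists r; rewrite (leq_trans h). Qed.

(** By relative smoothness test (c) can only fail when 1 / lambda < L. *)
Lemma reject_lambda_low s lambda kappa yhat : 0 < lambda ->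
  ga_reject_c half_sqnorm f s lambda kappa yhat ->
  lambda_low <= lambda / gammam.
Proof.
rewrite /ga_reject_c; set x := ga_x _ _ _ => l0 hc.
have := lt_le_trans hc (f_smooth yhat x); rewrite bregman_half_sqnorm.
rewrite -!EFinM lte_fin; set q := _ / 2 => hq.
have q0 : 0 <= q by rewrite divr_ge0 ?dotp_ge0.
have hl : lambda^-1 < L.
  by rewrite ltNge; apply: contraTN hq => hL; rewrite -leNgt ler_wpM2r.
rewrite ge_min; apply/orP; right.
rewrite div1r invfM mulrC ler_pM2r ?invr_gt0//.
by rewrite -[leRHS]invrK lef_pV2 ?posrE ?invr_gt0// ltW.
Qed.

Lemma run_invariant_step c c' m :
  run_invariant c m -> step c c' -> run_invariant c' m.+1.
Proof.
move=> inv st; case: st inv => /=.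
- by move=> k s _ [_ _ /solve_countS/solve_count_weaken ?]; exists (st_lambda s).
- by move=> k s _ [? hk /solve_countS hs]; rewrite mul1r divr1.
- by move=> k s lambda kappa yhat _ _ [_ _ /solve_countS ?]; exists lambda.
- move=> k s lambda kappa yhat _ _ hc [? ? [hl [r [hr hm]]]]; split=> //.
  split.
    by apply: reject_lambda_low hc; apply: lt_le_trans lambda_low_gt0 hl.
  exists r.+1; rewrite hr exprS invfM mulrCA mulrC addnS.
  by split; rewrite ?mulrA.
- move=> k s lambda kappa yhat hb _ hc hde [[_ om0 _ _] hk [hl _]].
  have l0 := lt_le_trans lambda_low_gt0 hl; exfalso.
  by apply: trial_no_reject_kappa hde => //; rewrite hk.
move=> k s lambda kappa yhat hb _ hc _ he [[hy om0 hgrow hlyap] hk hs].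
have l0 := lt_le_trans lambda_low_gt0 hs.1.
have k0 : 0 < kappa by rewrite hk.
split=> //.
split=> /=.
- exact: bpg_dom hb.
- by apply/ltW/ga_omega_gt0.
- rewrite -hk in hgrow *; apply: ga_omega_growth hgrow => //.
    exact/ltW/lambda_low_gt0.
  exact: hs.1.
move=> u hu; apply: le_trans (hlyap u hu).
exact: (trial_lyapunov rho_proper rho_convex f_proper f_convex).
Qed.

Lemma run_invariant_reach c m : reach c m -> run_invariant c m.
Proof.
elim=> [|c1 c2 k _ IH]; last exact: run_invariant_step IH.
split=> //; last first.
  by split; [rewrite /= ge_min lexx | exists 0%N; rewrite expr0 divr1].
by split=> //= [|u _]; rewrite ?expr0n ?mulr0 ?mul0r ?add0r.
Qed.

(** The Lyapunov bound gives omega_N (Phi(y_N) - Phi(u)) <= |u - y0|^2 / 2; the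
    lower bound on omega_N may be inserted only if the gap is positive, the
    other case being trivial. *)
Lemma reach_rate N s m u : (1 <= N)%N -> reach (Outer N s) m -> dom rho u ->
  Psi (st_y s) - Psi u <=
  kappa0 * enorm (u - y0) ^+ 2 / (lambda_low * N%:R ^+ 2).
Proof.
move=> N1 /run_invariant_reach [[_ om0 hgrow hlyap] _ _] /hlyap.
rewrite enorm_sq; move: (dotp_ge0 (u - y0)) (dotp_ge0 (u - st_z s)) => d0 dz0.
move: (dotp (u - y0) _) d0 (dotp (u - st_z s) _) dz0 (Psi _ - Psi _).
move=> d d0 dz dz0 gap {}hlyap.
have den0 : 0 < lambda_low * N%:R ^+ 2.
  by rewrite mulr_gt0 ?lambda_low_gt0// exprn_gt0// ltr0n.
rewrite ler_pdivlMr// mulrC; have [gap0|gap0] := leP gap 0.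
  apply: (@le_trans _ _ 0); last by rewrite mulr_ge0// ltW.
  by rewrite pmulr_rle0.
apply: le_trans (ler_wpM2r (ltW gap0) hgrow) _.
by rewrite -!mulrA mulrCA ler_pM2l//; lra.
Qed.

(** At most 2 N + J solves occur through iteration N, where J bounds the number
    of reductions of lambda in the run. *)
Lemma reach_solves : exists C : nat, forall (N : nat) c m,
  (1 <= N)%N -> reach c m -> ga_through N c -> (m <= C * N)%N.
Proof.
have [J hJ] := geometric_exponent_bounded (lambda0 / lambda_low) gammam_gt1.
exists (J + 2)%N => N c m N1 hreach hN.
suff [lambda [hl [r [hr hm]]]] : exists lambda, solve_count lambda N.*2 m.
  have rJ : (r <= J)%N.
    apply: hJ; rewrite ler_pdivlMr ?lambda_low_gt0// mulrC.
    by rewrite -ler_pdivlMr ?exprn_gt0// -hr.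
  rewrite (leq_trans hm)// mulnDl addnC mul2n leq_add2r.
  by rewrite (leq_trans rJ)// leq_pmulr.
have grow lambda b b' : solve_count lambda b m -> (b <= b')%N ->
    solve_count lambda b' m.
  move=> [hl [r [hr hm]]] bb; split=> //; exists r; split=> //.
  by rewrite (leq_trans hm)// leq_add2r.
case: c hreach hN => [k s|k s lambda kappa|k x] /run_invariant_reach /= inv hN.
- case: inv => _ _ /grow h; exists (st_lambda s).
  by apply: h; rewrite leq_double.
- by case: inv => _ _ /grow h; exists lambda; apply: h; rewrite ltn_double.
- case: inv => lambda /grow h; exists lambda.
  by apply: h; rewrite -doubleS leq_double.
Qed.

End Run.

Theorem mainTheorem4 (R : realType) (n : nat)
    (psi f rho phi : 'rV[R]_n -> \bar R) (L : R)
    (y0 : 'rV[R]_n) (lambda0 kappa0 gammap gammam gammak : R)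
    (Hstanding : standing_assumptions psi f rho L)
    (Hsolvable : solvable psi f rho)
    (Hfconvex : econvex f)
    (Hpsi : psi = half_sqnorm)
    (Hphi : phi = half_sqnorm)
    (HOmega : Omega psi = setT)
    (Hinputs : ga_inputs psi rho phi y0 lambda0 kappa0 gammap gammam gammak)
    (Hgammap : gammap = 1)
    (Hkappa0 : 2 <= kappa0) :
  let z0 := y0 in
  let lambda_low := Num.min lambda0 (1 / (gammam * L)) in
  let reach :=
    ga_reach psi f rho phi y0 lambda0 kappa0 gammap gammam gammak in
  [/\ (forall (k : nat) (s : ga_state) (m : nat),
         (1 <= k)%N -> reach (Outer k s) m ->
         lambda_low <= st_lambda s /\ st_kappa s = kappa0),
      (forall (N : nat) (s : ga_state) (m : nat) (u : 'rV[R]_n),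
         (1 <= N)%N -> reach (Outer N s) m -> dom (Phi f rho) u ->
         (Phi f rho (st_y s) - Phi f rho u <=
            (kappa0 * enorm (u - z0) ^+ 2 / (lambda_low * N%:R ^+ 2))%:E)%E)
    & (exists C : nat, forall (N : nat) (c : ga_config) (m : nat),
         (1 <= N)%N -> reach c m -> ga_through N c -> (m <= C * N)%N)].
Proof.
move=> z0 lambda_low reach.
case: Hstanding => _ fp _ fdom fdiff _ rp _ rc _ L0 fsm _.
case: Hinputs => _ _ y0r _ l0 k0 _ gm _.
have {}fdom x : dom f x by apply: fdom; rewrite Hpsi dom_half_sqnorm.
have {}fdiff x : differentiable (fine \o f) x by apply: fdiff; rewrite HOmega.
have {}fsm u v : (bregman f u v <= L%:E * bregman half_sqnorm u v)%E.
  by rewrite -Hpsi; apply: fsm; rewrite HOmega.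
move: @reach; rewrite Hpsi Hphi Hgammap => reach.
split.
- move=> k s m _ /(run_invariant_reach rp rc fp Hfconvex fdom fdiff L0 fsm l0
    Hkappa0 gm y0r)[_ hk [hl _]]; split=> //.
- move=> N s m u N1 hreach hu.
  have hy : dom rho (st_y s).
    by have [[]] := run_invariant_reach rp rc fp Hfconvex fdom fdiff L0 fsm l0
      Hkappa0 gm y0r hreach.
  have fin v : f v \is a fin_num := dom_fin_num fp (fdom v).
  have hru : dom rho u.
    move: hu; rewrite /dom /Phi /= -(fineK (fin u)).
    by case: (rho u) => [r _| |//]; [exact: ltry|].
  have := reach_rate rp rc fp Hfconvex fdom fdiff L0 fsm l0 Hkappa0 gm y0r N1
    hreach hru.
  rewrite -lee_fin EFinB !EFinD.
  by rewrite !(fineK (fin _)) !(fineK (dom_fin_num rp _)).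
- exact: (reach_solves gammak rp rc fp Hfconvex fdom fdiff L0 fsm l0
    Hkappa0 gm y0r).
Qed.
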